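(* Let $X, Y$ be non-zero ordered normed spaces with the following properties: (1) The cone $X_+$ is total, there exists an equivalent norm on $X$ that is additive on $X_+$, and every extremal vector of $X_+$ is also extremal in the bidual cone $X''_+$ (where $X$ is identified with its canonical image in $X''$). Moreover, the convex hull of the extremal vectors in $X_+$ is dense in $X_+$. (2) The cone $Y_+$ has non-empty interior. Let $y_0$ be an interior point of $Y_+$ and $x_0'$ an interior point of $X'_+$, let $$S' := \big\{ y' \otimes x : x \text{ is extremal in } X_+,\ y' \text{ is extremal in } Y'_+, \text{ and } \langle y', y_0\rangle \langle x_0', x\rangle = 1 \big\} \subseteq \mathcal{C}(X,Y)',$$ endow the weak-$*$ closure $\overline{S'}$ with the weak-$*$ topology, and let $\Phi : \mathcal{C}(X,Y) \to \mathrm{C}(\overline{S'})$ be given by $\Phi(T)(\varphi) = \langle\varphi, T\rangle$. For an operator $T \in \mathcal{C}(X,Y)$, the following statements are equivalent: (i) $T$ has a modulus in $\mathcal{C}(X,Y)$. (ii) There is $\tau \in \Phi[\mathcal{C}(X,Y)]$ such that the pointwise modulus of $\Phi(T)$ restricted to $S'$ equals $\tau|_{S'}$. (iii) There are positive disjoint operators $T_1, T_2 \in \mathcal{C}(X,Y)$ such that $T = T_1 - T_2$.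
   Context: All vector spaces are real. A wedge in a real vector space $V$ is a non-empty subset $V_+$ with $\alpha V_+ + \beta V_+ \subseteq V_+$ for all real $\alpha,\beta \ge 0$; it is a cone if in addition $V_+ \cap (-V_+) = \{0\}$. One writes $x \le y$ if $y - x \in V_+$, and $[v_1,v_2] = \{x \in V : v_1 \le x \le v_2\}$. A vector $v \in V_+$ is called extremal in $V_+$ (an extremal vector of $V_+$) if all elements of $[0,v]$ are scalar multiples of $v$. An ordered normed space is a normed space $X$ (not necessarily complete) endowed with a norm closed cone $X_+$. The cone $X_+$ is total if its linear span is norm dense in $X$. A norm on $X$ is additive on $X_+$ if $\|x_1+x_2\| = \|x_1\|+\|x_2\|$ for all $x_1,x_2\in X_+$. The norm dual $X'$ is endowed with the dual wedge $X'_+ = \{x' \in X' : \langle x', x\rangle \ge 0 \text{ for all } x \in X_+\}$; the bidual $X''$ is endowed with $X''_+ = \{x'' \in X'' : \langle x'', x'\rangle \ge 0 \text{ for all } x' \in X'_+\}$. Interior points are meant with respect to the norm topologies. $\mathcal{L}(X,Y)$ is the space of bounded linear operators from $X$ to $Y$ with the operator norm, and $\mathcal{L}(X,Y)_+ = \{T \in \mathcal{L}(X,Y): T[X_+] \subseteq Y_+\}$. $\mathcal{C}(X,Y)$ is the operator norm closure in $\mathcal{L}(X,Y)$ of the subspace of bounded finite rank operators, ordered by $\mathcal{C}(X,Y)_+ = \mathcal{C}(X,Y) \cap \mathcal{L}(X,Y)_+$. For $x \in X$ and $y' \in Y'$, the functional $y' \otimes x \in \mathcal{C}(X,Y)'$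 is given by $\langle y' \otimes x, T\rangle = \langle y', Tx\rangle$. The weak-$*$ topology on $\mathcal{C}(X,Y)'$ is the topology of pointwise convergence on $\mathcal{C}(X,Y)$, and $\mathrm{C}(K)$ denotes the continuous real-valued functions on $K$. $T$ has a modulus in $\mathcal{C}(X,Y)$ if the supremum of $\{T,-T\}$ exists in the ordered vector space $\mathcal{C}(X,Y)$. Two positive elements of $\mathcal{C}(X,Y)$ are disjoint if their infimum in $\mathcal{C}(X,Y)$ exists and equals $0$. *)

(* Defs.v *)
From HB Require Import structures.
From mathcomp Require Import all_boot all_order all_algebra.
From mathcomp Require Import all_classical all_reals all_analysis.
Import Order.TTheory GRing.Theory Num.Theory.
Import numFieldNormedType.Exports.

Set Implicit Arguments.
Unset Strict Implicit.
Unset Printing Implicit Defensive.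

Local Open Scope classical_set_scope.
Local Open Scope ring_scope.

Section wedges.
Context {R : realType} {V : lmodType R}.
Implicit Types (W A : set V) (u v x s : V).

Definition is_wedge W := W !=set0 /\
  forall (a b : R) x y, 0 <= a -> 0 <= b -> W x -> W y -> W (a *: x + b *: y).

Definition is_cone W := is_wedge W /\ forall x, W x -> W (- x) -> x = 0.

Definition wle W x y : Prop := W (y - x).

Definition order_interval W u v : set V := [set x | wle W u x /\ wle W x v].

Definition extremal W : set V :=
  [set v | W v /\ forall x, order_interval W 0 v x -> exists a : R, x = a *: v].

Definition is_sup W A s := (forall x, A x -> wle W x s) /\
  forall u, (forall x, A x -> wle W x u) -> wle W s u.

Definition is_inf W A s := (forall x, A x -> wle W s x) /\
  forall u, (forall x, A x -> wle W u x) -> wle W u s.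

Definition has_modulus W x := exists s, is_sup W [set x; - x] s.

Definition disjoint_elts W x y := is_inf W [set x; y] 0.

Definition lspan A : set V := [set x | exists (n : nat) (c : 'I_n -> R)
  (v : 'I_n -> V), (forall i, A (v i)) /\ x = \sum_(i < n) c i *: v i].

Definition convex_hull A : set V := smallest (@convex_set R V) A.

End wedges.

Section norms.
Context {R : realType} {X : normedModType R}.

Definition is_norm (N : X -> R) := [/\ forall x y, N (x + y) <= N x + N y,
  forall (a : R) x, N (a *: x) = `|a| * N x & forall x, N x = 0 -> x = 0].

Definition equivalent_norm (N : X -> R) := is_norm N /\
  exists m M : R, [/\ 0 < m, 0 < M & forall x, m * `|x| <= N x <= M * `|x|].

Definition additive_on (W : set X) (N : X -> R) :=
  forall x y, W x -> W y -> N (x + y) = N x + N y.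

Definition total_wedge (W : set X) := closure (lspan W) = setT.

End norms.

Section bounded_operators.
Context {R : realType} (X Y : normedModType R).

Definition bounded_linear : {pred X -> Y} := fun f =>
  `[< linear f /\ exists M : R, forall x, `|f x| <= M * `|x| >].

Lemma bounded_linearP (f : X -> Y) : reflect
  (linear f /\ exists2 M : R, 0 <= M & forall x, `|f x| <= M * `|x|)
  (f \in bounded_linear).
Proof.
rewrite unfold_in; apply: (iffP (asboolP _)) => -[fl].
  move=> [M fM]; split => //; exists `|M| => // x.
  by apply: le_trans (fM x) _; rewrite ler_wpM2r// ler_norm.
by move=> [M _ fM]; split => //; exists M.
Qed.

Lemma bounded_linear_submod : submod_closed bounded_linear.
Proof.
split.
  apply/bounded_linearP; split; first by move=> a u v /=; rewrite scaler0 addr0.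
  by exists 0 => // x; rewrite /= normr0 mul0r.
move=> a f g /bounded_linearP[fl [M M0 fM]] /bounded_linearP[gl [N N0 gN]].
apply/bounded_linearP; split.
  move=> b u v; rewrite /= !fctE fl gl !scalerDr !scalerA mulrC -!addrA.
  by congr (_ + _); rewrite addrCA.
exists (`|a| * M + N); first by rewrite addr_ge0// mulr_ge0.
move=> x; rewrite mulrDl; apply: le_trans (ler_normD _ _) _.
by rewrite lerD// normrZ -mulrA ler_wpM2l.
Qed.

HB.instance Definition _ :=
  GRing.isSubmodClosed.Build R (X -> Y) bounded_linear bounded_linear_submod.

Record bounded_op := BoundedOp {
  bop_val :> X -> Y; bop_valP : bop_val \in bounded_linear }.

HB.instance Definition _ := [isSub for bop_val].
HB.instance Definition _ := [Choice of bounded_op by <:].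
HB.instance Definition _ := [SubChoice_isSubLmodule of bounded_op by <:].

Lemma bop_linear (T : bounded_op) : linear T.
Proof. by have /bounded_linearP[] := bop_valP T. Qed.

HB.instance Definition _ (T : bounded_op) :=
  GRing.isLinear.Build R X Y _ (bop_val T) (bop_linear T).

Definition op_norm (T : bounded_op) : R :=
  sup [set `|T x| | x in [set x | `|x| <= 1]].

Lemma op_norm_bounded (T : bounded_op) :
  has_sup [set `|T x| | x in [set x | `|x| <= 1]].
Proof.
split; first by exists 0; exists 0; rewrite /= ?linear0 ?normr0.
have /bounded_linearP[_ [M M0 TM]] := bop_valP T.
exists M => _ [x /= x1 <-]; apply: le_trans (TM x) _.
by rewrite ler_piMr.
Qed.

Lemma op_norm_ge0 (T : bounded_op) : 0 <= op_norm T.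
Proof.
apply: ub_le_sup; first by case: (op_norm_bounded T).
by exists 0; rewrite /= ?linear0 ?normr0.
Qed.

Lemma op_norm_le (T : bounded_op) x : `|T x| <= op_norm T * `|x|.
Proof.
have [->|x0] := eqVneq x 0; first by rewrite linear0 !normr0 mulr0.
rewrite -ler_pdivrMr ?normr_gt0//.
apply: ub_le_sup; first by case: (op_norm_bounded T).
exists (`|x|^-1 *: x).
  by rewrite /= normrZ ger0_norm ?invr_ge0// mulVf// normr_eq0.
by rewrite linearZ normrZ ger0_norm ?invr_ge0// mulrC.
Qed.

Lemma op_norm_min (T : bounded_op) (M : R) :
  (forall x, `|x| <= 1 -> `|T x| <= M) -> op_norm T <= M.
Proof.
move=> TM; apply: sup_le_ub; first by case: (op_norm_bounded T).
by move=> _ [x /= x1 <-]; exact: TM.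
Qed.

Lemma op_normD (S T : bounded_op) : op_norm (S + T) <= op_norm S + op_norm T.
Proof.
apply: op_norm_min => x x1; apply: le_trans (ler_normD _ _) _.
by apply: lerD; apply: le_trans (op_norm_le _ _) _; rewrite ler_piMr// op_norm_ge0.
Qed.

Lemma op_normZ (a : R) (T : bounded_op) : op_norm (a *: T) = `|a| * op_norm T.
Proof.
have le b S : op_norm (b *: S) <= `|b| * op_norm S.
  apply: op_norm_min => x x1; rewrite [_ x](_ : _ = b *: S x)// normrZ.
  rewrite ler_wpM2l//; apply: le_trans (op_norm_le _ _) _.
  by rewrite ler_piMr// op_norm_ge0.
apply/eqP; rewrite eq_le le/=; have [->|a0] := eqVneq a 0.
  by rewrite normr0 mul0r op_norm_ge0.
rewrite -ler_pdivlMl ?normr_gt0// -normfV.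
by apply: le_trans (le _ _); rewrite scalerA mulVf// scale1r.
Qed.

Lemma op_norm_eq0 (T : bounded_op) : op_norm T = 0 -> T = 0.
Proof.
move=> T0; apply: val_inj; apply/funext => x; apply/eqP.
by rewrite -normr_le0 (le_trans (op_norm_le T x))// T0 mul0r.
Qed.

HB.instance Definition _ :=
  Lmodule_isNormed.Build R bounded_op op_normD op_normZ op_norm_eq0.

Definition positive_ops (Xp : set X) (Yp : set Y) : set bounded_op :=
  [set T | T @` Xp `<=` Yp].

Definition finite_rank : set bounded_op :=
  [set T | exists2 B : set Y, finite_set B & range T `<=` lspan B].

End bounded_operators.

Arguments bounded_linear {R} X Y.

Section approximable_operators.
Context {R : realType} (X Y : normedModType R).

Definition approximable : {pred bounded_op X Y} := fun T =>
  `[< closure (@finite_rank R X Y) T >].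

Lemma finite_rank_submod (a : R) (S T : bounded_op X Y) :
  finite_rank S -> finite_rank T -> finite_rank (a *: S + T).
Proof.
move=> [A fA SA] [B fB TB]; exists (A `|` B); first by rewrite finite_setU.
move=> _ [x _ <-].
have [n [c [v [Av Sx]]]] := SA _ (imageP S (I : [set: X] x)).
have [m [d [w [Bw Tx]]]] := TB _ (imageP T (I : [set: X] x)).
exists (n + m)%N.
exists (fun i : 'I_(n + m) => match fintype.split i with inl j => a * c j | inr j => d j end).
exists (fun i : 'I_(n + m) => match fintype.split i with inl j => v j | inr j => w j end).
split; first by move=> i; case: (fintype.split i) => j; [left|right].
rewrite [LHS](_ : _ = a *: S x + T x)// Sx Tx big_split_ord/= scaler_sumr.
congr (_ + _); apply: eq_bigr => i _.
  by rewrite (unsplitK (inl i)) scalerA.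
by rewrite (unsplitK (inr i)).
Qed.

Lemma closure_finite_rankP (T : bounded_op X Y) : closure (@finite_rank R X Y) T <->
  forall e : R, 0 < e -> exists2 S : bounded_op X Y, finite_rank S & `|T - S| < e.
Proof.
split=> [cT e e0|cT B].
  have [S [fS TS]] := cT _ (nbhsx_ballx T e e0).
  by exists S => //; move: TS; rewrite -ball_normE.
rewrite -nbhs_ballE => -[e /= e0 eB]; have [S fS TS] := cT _ e0.
by exists S; split => //; apply: eB; rewrite -ball_normE.
Qed.

Lemma approximable_submod : submod_closed approximable.
Proof.
split.
  apply/asboolP; apply: subset_closure; exists set0 => // _ [x _ <-].
  exists 0%N, (fun=> 0), (fun=> 0); split; first by case.
  by rewrite big_ord0.
move=> a S T /asboolP/closure_finite_rankP cS /asboolP/closure_finite_rankP cT.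
apply/asboolP/closure_finite_rankP => e e0.
have k0 : 0 < e / 2 / (`|a| + 1) by rewrite !divr_gt0// ltr_wpDl.
have [S' fS SS'] := cS _ k0.
have [T' fT TT'] := cT _ (divr_gt0 e0 (@ltr0Sn R 1)).
exists (a *: S' + T'); first exact: finite_rank_submod.
rewrite opprD addrACA -scalerBr (le_lt_trans (ler_normD _ _))//.
rewrite [ltRHS]splitr ler_ltD// normrZ.
apply: (@le_trans _ _ ((`|a| + 1) * `|S - S'|)).
  by rewrite ler_wpM2r// lerDl.
by rewrite mulrC -ler_pdivlMr ?ltr_wpDl// ltW.
Qed.

HB.instance Definition _ := GRing.isSubmodClosed.Build R (bounded_op X Y)
  approximable approximable_submod.

(* The carrier of C(X, Y), with the operator norm inherited from L(X, Y). *)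
Record approx_op := ApproxOp {
  aop_val :> bounded_op X Y; aop_valP : aop_val \in approximable }.

HB.instance Definition _ := [isSub for aop_val].
HB.instance Definition _ := [Choice of approx_op by <:].
HB.instance Definition _ := [SubChoice_isSubLmodule of approx_op by <:].

Definition aop_norm (T : approx_op) : R := `|aop_val T|.

Lemma aop_normD S T : aop_norm (S + T) <= aop_norm S + aop_norm T.
Proof. exact: ler_normD. Qed.

Lemma aop_normZ (a : R) T : aop_norm (a *: T) = `|a| * aop_norm T.
Proof. exact: normrZ. Qed.

Lemma aop_norm_eq0 T : aop_norm T = 0 -> T = 0.
Proof. by move=> /normr0_eq0 T0; exact: val_inj. Qed.

HB.instance Definition _ :=
  Lmodule_isNormed.Build R approx_op aop_normD aop_normZ aop_norm_eq0.

Definition positive_aops (Xp : set X) (Yp : set Y) : set approx_op :=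
  [set T | positive_ops Xp Yp (aop_val T)].

End approximable_operators.

Section duality.
Context {R : realType}.
Implicit Types X Y E : normedModType R.

(* Carries the operator (dual) norm topology; [weak_star] below is the same
   carrier with the topology of pointwise convergence. *)
Definition dual X := bounded_op X R.

Definition dual_wedge X (W : set X) : set (dual X) :=
  [set x' | forall x, W x -> 0 <= x' x].

Lemma bidual_embedding_bounded X (x : X) :
  (fun x' : dual X => x' x : R) \in bounded_linear (dual X) R.
Proof.
apply/bounded_linearP; split => [a f g|]; first by [].
by exists `|x| => // f; rewrite mulrC; exact: op_norm_le.
Qed.

Definition bidual_embedding X (x : X) : dual (dual X) :=
  BoundedOp (bidual_embedding_bounded x).

Lemma tensor_bounded X Y (y' : dual Y) (x : X) :
  (fun T : approx_op X Y => y' (T x) : R) \in bounded_linear (approx_op X Y) R.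
Proof.
apply/bounded_linearP; split => [a S T|].
  by rewrite [(_ : X -> Y) x](_ : _ = a *: S x + T x)// linearP.
exists (`|y'| * `|x|); first exact: mulr_ge0.
move=> T; apply: le_trans (op_norm_le y' (T x)) _.
by rewrite -mulrA ler_wpM2l ?op_norm_ge0// mulrC; exact: op_norm_le.
Qed.

Definition tensor X Y (y' : dual Y) (x : X) : dual (approx_op X Y) :=
  BoundedOp (tensor_bounded y' x).

Definition weak_star E : Type :=
  initial_topology (fun f : dual E => (f : E -> R) : {ptws E -> R}).

HB.instance Definition _ E := Topological.on (weak_star E).

Lemma evaluation_continuous E (K : set (weak_star E)) (x : E) :
  continuous (fun phi : K => (set_val phi : dual E) x : R).
Proof.
have h : continuous (fun phi : weak_star E => (phi : dual E) x : R).
  move=> phi.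
  apply: (@continuous_comp (weak_star E) {ptws E -> R} R
    (fun f => f : E -> R) (proj x)); first exact: initial_continuous.
  exact: proj_continuous.
move=> phi; apply: (@continuous_comp K (weak_star E) R set_val
  (fun f => (f : dual E) x)); last exact: h.
exact: initial_continuous.
Qed.

(* For E = C(X, Y) and K the weak-star closure of S', this is the map Phi from
   C(X, Y) to C(K). *)
Definition evaluation E (K : set (weak_star E)) (x : E) : continuousType K R :=
  mkcts (@evaluation_continuous E K x).

Definition extremal_tensors X Y (Xp : set X) (Yp : set Y) (x0' : dual X)
    (y0 : Y) : set (weak_star (approx_op X Y)) :=
  [set phi | exists (x : X) (y' : dual Y), [/\ extremal Xp x,
     extremal (dual_wedge Yp) y', y' y0 * x0' x = 1 & phi = tensor y' x]].

End duality.

(* Main.v *)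
Require Import Defs.
From HB Require Import structures.
From mathcomp Require Import all_boot all_order all_algebra.
From mathcomp Require Import all_classical all_reals all_analysis.
From mathcomp Require Import ring lra.
Import Order.TTheory GRing.Theory Num.Theory.
Import numFieldNormedType.Exports.

Local Open Scope classical_set_scope.
Local Open Scope ring_scope.

(** Write [E] for the space of approximable operators and [Cp] for its positive
    cone.  Everything rests on two properties of the functionals
    [tensor y' x] in [S'].

    They determine the order of [E]: an operator which is nonnegative on [S']
    is positive ([positive_aops_from_extremal]).  By the density of the convex
    hull of the extremal vectors it is enough to have [T x] in [Yp] for [x]
    extremal, and a closed wedge with an interior point [e] is determined by the
    extremal functionals of its dual wedge ([extremal_forms_determine_wedge]), a
    Krein-Milman argument on the base [y' e = 1].

    They are extremal in the dual wedge of [Cp] ([tensor_extremal]).  If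
    [0 <= psi <= tensor y' x] and [y] is in [Yp], the functional
    [f |-> psi (rank_one f y)] on the dual of [X] lies between [0] and
    [y' y *: x] in the bidual, so it is a multiple of [x]: this is where
    extremality in the bidual cone is needed.  The factor depends linearly on
    [y] and lies between [0] and a multiple of [y'], hence is a multiple of
    [y'].  So [psi] agrees with a multiple of [tensor y' x] on rank one
    operators, and then on all of [E] by linearity and density
    ([eq0_approx_op]).

    An extremal positive functional [phi] of a space with an order unit
    preserves existing moduli ([extremal_form_modulus]): the sublinear map
    sending [v] to the infimum of [phi u] over all [u] above [0] and [v]
    dominates a positive functional below [phi], hence a multiple [a * phi] with
    [0 <= a <= 1], which attains it at the given vector [x].  So a modulus of
    [T] is mapped by every member of [S'] to the absolute value of the image of
    [T].  Conversely an operator whose image on [S'] is that absolute value is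
    the supremum of [T] and [- T], because [S'] determines the order.  The
    equivalence with a disjoint decomposition holds in every ordered vector
    space, where [T1] and [T2] are
    the halves of [S + T] and [S - T] for a modulus [S] of [T].

    The Hahn-Banach and Krein-Milman arguments all come from one statement,
    [extremal_hahn_banach]: among the linear forms below a sublinear map there
    is an extreme one attaining the bound at a prescribed vector. *)

(** * Extreme linear forms below a sublinear map *)

Section sublinear.
Context {R : realType} {V : lmodType R}.
Implicit Types (p q f g h : V -> R) (u v x y : V).

Definition sublinear q := (forall x y, q (x + y) <= q x + q y) /\
  forall a x, 0 <= a -> q (a *: x) <= a * q x.

Definition linear_form f := forall a x y, f (a *: x + y) = a * f x + f y.

Lemma linear_formD f : linear_form f -> forall x y, f (x + y) = f x + f y.
Proof. by move=> lf x y; rewrite -[x in LHS]scale1r lf mul1r. Qed.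

Lemma linear_form0 f : linear_form f -> f 0 = 0.
Proof.
move=> lf; have := linear_formD f lf 0 0.
by rewrite addr0 => /eqP; rewrite -subr_eq subrr => /eqP.
Qed.

Lemma linear_formZ f : linear_form f -> forall a x, f (a *: x) = a * f x.
Proof. by move=> lf a x; rewrite -[a *: x]addr0 lf linear_form0// addr0. Qed.

Lemma linear_formN f : linear_form f -> forall x, f (- x) = - f x.
Proof. by move=> lf x; rewrite -scaleN1r linear_formZ// mulN1r. Qed.

Lemma linear_form_le_eq f g : linear_form f -> linear_form g ->
  (forall v, f v <= g v) -> forall v, f v = g v.
Proof.
move=> lf lg fg v; apply/eqP; rewrite eq_le fg/=.
by have := fg (- v); rewrite !linear_formN// lerN2.
Qed.

Lemma sublinear0 q : sublinear q -> q 0 = 0.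
Proof.
move=> [qD qZ]; have := qZ 0 0 (lexx 0); have := qD 0 0.
by rewrite scale0r addr0; lra.
Qed.

Lemma sublinearZ q : sublinear q -> forall a x, 0 <= a -> q (a *: x) = a * q x.
Proof.
move=> sq a x; rewrite le_eqVlt => /predU1P[<-|a0].
  by rewrite scale0r mul0r sublinear0.
have qa := sq.2 a x (ltW a0); apply/eqP; rewrite eq_le qa/= -ler_pdivlMl//.
have := sq.2 a^-1 (a *: x); rewrite scalerA mulVf ?gt_eqF// scale1r; apply.
by rewrite invr_ge0 ltW.
Qed.

Lemma sublinearN q x : sublinear q -> - q (- x) <= q x.
Proof.
by move=> sq; have := sq.1 x (- x); rewrite subrr sublinear0//; lra.
Qed.

Lemma sublinear_odd q : sublinear q -> (forall v, q (- v) <= - q v) ->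
  linear_form q.
Proof.
move=> sq qN; have qNE v : q (- v) = - q v.
  by apply/eqP; rewrite eq_le qN/= lerNl; exact: sublinearN.
have qD x y : q (x + y) = q x + q y.
  apply/eqP; rewrite eq_le sq.1/=.
  by have := sq.1 (- x) (- y); rewrite -opprD !qNE; lra.
have qZ a x : q (a *: x) = a * q x.
  have [a0|a0] := leP 0 a; first exact: sublinearZ.
  rewrite -[a]opprK scaleNr qNE sublinearZ ?mulNr//; lra.
by move=> a x y; rewrite qD qZ.
Qed.

(** Support function of the face of those linear forms below [q] which take the
    largest possible value [q v] at [v]. *)
Definition slice q v y :=
  inf [set q (y + t *: v) - t * q v | t in [set t : R | 0 <= t]].

Lemma slice_lb q v y : sublinear q ->
  lbound [set q (y + t *: v) - t * q v | t in [set t : R | 0 <= t]] (- q (- y)).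
Proof.
move=> sq _ [t /= t0 <-].
have := sq.1 (- y) (y + t *: v); rewrite addKr sublinearZ//; lra.
Qed.

Lemma slice_le q v y t : sublinear q -> 0 <= t ->
  slice q v y <= q (y + t *: v) - t * q v.
Proof.
move=> sq t0; apply: ge_inf; first by eexists; exact: slice_lb.
by exists t.
Qed.

Lemma slice_ge q v y z : (forall t, 0 <= t -> z <= q (y + t *: v) - t * q v) ->
  z <= slice q v y.
Proof.
move=> zq; apply: lb_le_inf; first by exists (q (y + 0 *: v) - 0 * q v), 0 => /=.
by move=> _ [t /= t0 <-]; exact: zq.
Qed.

Lemma slice_le_id q v y : sublinear q -> slice q v y <= q y.
Proof.
by move=> sq; have := slice_le _ v y _ sq (lexx 0); rewrite scale0r addr0 mul0r subr0.
Qed.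

Lemma slice_opp q v : sublinear q -> slice q v (- v) <= - q v.
Proof.
move=> sq; have := slice_le _ v (- v) _ sq ler01.
by rewrite scale1r addNr sublinear0// mul1r sub0r.
Qed.

Lemma slice_sublinear q v : sublinear q -> sublinear (slice q v).
Proof.
move=> sq; split=> [x y|a x a0].
  rewrite -lerBlDr; apply: slice_ge => s s0.
  rewrite lerBlDr -lerBlDl; apply: slice_ge => t t0.
  rewrite lerBlDl; apply: le_trans (slice_le q v (x + y) (s + t) sq _) _.
    exact: addr_ge0.
  by rewrite scalerDl addrACA; have := sq.1 (x + s *: v) (y + t *: v); lra.
move: a0; rewrite le_eqVlt => /predU1P[<-|a0].
  by rewrite scale0r mul0r (le_trans (slice_le_id _ _ _ sq))// sublinear0.
rewrite -ler_pdivrMl//; apply: slice_ge => t t0; rewrite ler_pdivrMl//.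
apply: le_trans (slice_le _ v (a *: x) (a * t) sq _) _.
  by rewrite mulr_ge0// ltW.
by rewrite -scalerA -scalerDr sublinearZ ?(ltW a0)// mulrBr mulrA.
Qed.

(** A face of the convex set of linear forms below [p], encoded by its support
    function [q].  Intersections of faces become pointwise infima, so that no
    weak-star compactness is involved. *)
Definition supports_face p q := [/\ sublinear q, forall v, q v <= p v &
  forall f g c, linear_form f -> linear_form g ->
    (forall v, f v <= p v) -> (forall v, g v <= p v) -> 0 < c < 1 ->
    (forall v, c * f v + (1 - c) * g v <= q v) -> forall v, f v <= q v].

(** If a proper convex combination of [f] and [g] attains the maximum [q v] at
    [v], then so do both [f] and [g]; hence a slice of a face is a face. *)
Lemma slice_supports_face p q v :
  supports_face p q -> supports_face p (slice q v).
Proof.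
move=> [sq qp qface]; split; first exact: slice_sublinear.
  by move=> y; apply: le_trans (slice_le_id _ _ _ sq) (qp y).
move=> f g c lf lg fp gp c01 fgq y.
have cfgq w : c * f w + (1 - c) * g w <= q w.
  by apply: le_trans (fgq w) (slice_le_id _ _ _ sq).
have fq : forall w, f w <= q w by apply: (qface f g c).
have gq : forall w, g w <= q w.
  apply: (qface g f (1 - c)) => //; first by lra.
  by move=> w; have := cfgq w; lra.
have fv : f v = q v.
  apply/eqP; rewrite eq_le fq/=.
  have := le_trans (fgq (- v)) (slice_opp _ v sq); rewrite !linear_formN//.
  by have := fq v; have := gq v; nra.
apply: slice_ge => t t0.
by have := fq (y + t *: v); rewrite linear_formD// linear_formZ// fv; lra.
Qed.

(** A pointwise infimum of sublinear maps need not be subadditive; along a chain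
    it is, since two members can be replaced by the smaller one. *)
Lemma chain_inf_supports_face p (A : set (V -> R)) : A !=set0 ->
  (forall q, A q -> supports_face p q) ->
  (forall q r, A q -> A r -> (forall v, q v <= r v) \/ (forall v, r v <= q v)) ->
  exists2 s, supports_face p s & forall q, A q -> forall v, s v <= q v.
Proof.
move=> [q0 Aq0] Aface Atot.
have As q : A q -> sublinear q by move=> /Aface[].
pose s v := inf [set q v | q in A].
have s_le q v : A q -> s v <= q v.
  move=> Aq; apply: ge_inf; last by exists q.
  exists (- p (- v)) => _ [r Ar <-].
  have [sr rp _] := Aface _ Ar.
  by have := rp (- v); have := sublinearN _ v sr; lra.
have s_ge v z : (forall q, A q -> z <= q v) -> z <= s v.
  move=> zq; apply: lb_le_inf; first by exists (q0 v), q0.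
  by move=> _ [q Aq <-]; exact: zq.
exists s; last by move=> q Aq v; exact: s_le.
split.
- split=> [x y|a x].
    rewrite -lerBlDr; apply: (s_ge) => q Aq.
    rewrite lerBlDr -lerBlDl; apply: (s_ge) => r Ar.
    rewrite lerBlDl.
    have [qr|rq] := Atot _ _ Aq Ar.
      have := (As q Aq).1 x y; have := s_le q (x + y) Aq; have := qr y; lra.
    have := (As r Ar).1 x y; have := s_le r (x + y) Ar; have := rq x; lra.
  rewrite le_eqVlt => /predU1P[<-|a0].
    rewrite scale0r mul0r; apply: le_trans (s_le _ _ Aq0) _.
    by rewrite (sublinear0 _ (As _ Aq0)).
  rewrite -ler_pdivrMl//; apply: (s_ge) => q Aq; rewrite ler_pdivrMl//.
  apply: le_trans (s_le _ _ Aq) _.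
  by rewrite (sublinearZ _ (As _ Aq)) ?(ltW a0).
- by move=> v; have [_ qp _] := Aface _ Aq0; exact: le_trans (s_le _ _ Aq0) _.
- move=> f g c lf lg fp gp c01 fgs v; apply: (s_ge) => q Aq.
  have [_ _ qface] := Aface _ Aq.
  apply: (qface f g c) => // w; apply: le_trans (fgs w) (s_le _ _ Aq).
Qed.

Lemma minimal_supporting_face p q0 : supports_face p q0 ->
  exists q, [/\ supports_face p q, forall v, q v <= q0 v &
    forall r, supports_face p r -> (forall v, r v <= q v) -> r = q].
Proof.
move=> fq0; pose P q := supports_face p q /\ forall v, q v <= q0 v.
pose R' (q r : {q | P q}) : bool := `[< forall v, sval r v <= sval q v >].
have [||||[q Pq] qmin] := @Zorn {q | P q} R'.
- by move=> q; apply/asboolP.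
- move=> q r s /asboolP qr /asboolP rs; apply/asboolP => v.
  exact: le_trans (rs v) (qr v).
- move=> [q Pq] [r Pr] /asboolP/= qr /asboolP/= rq; apply: eq_exist.
  by apply/funext => v; apply/eqP; rewrite eq_le rq qr.
- move=> A Atot; have [[[q1 Pq1] Aq1]|A0] := pselect (A !=set0); last first.
    by exists (exist P q0 (conj fq0 (fun v => lexx _))) => q Aq; case: A0; exists q.
  have [|_ [[q [fq qq0]] Aq <-]//|_ _ [q Aq <-] [r Ar <-]|s fs sA] :=
      chain_inf_supports_face p [set sval q | q in A].
  + by exists q1, (exist P q1 Pq1).
  + by have [/asboolP ?|/asboolP ?] := Atot _ _ Aq Ar; [right|left].
  have Ps : P s.
    split => // v; apply: le_trans (Pq1.2 v).
    by apply: sA; exists (exist P q1 Pq1).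
  exists (exist P s Ps) => q Aq; apply/asboolP => /= v.
  by apply: sA; exists q.
- have [fq qq0] := Pq; exists q; split => // r fr rq.
  have Pr : P r by split => // v; exact: le_trans (rq v) (qq0 v).
  suff /(congr1 sval) : exist P r Pr = exist P q Pq by [].
  by apply: qmin; apply/asboolP.
Qed.

(** A minimal face [q] coincides with all its slices, and [slice_opp] then makes
    [q] odd, hence linear: a minimal face is a single extreme form.  Starting
    from the slice at [v0] forces that form to attain [p v0]. *)
Theorem extremal_hahn_banach p v0 : sublinear p -> exists f, [/\ linear_form f,
  forall v, f v <= p v, f v0 = p v0 &
  forall g h c, linear_form g -> linear_form h ->
    (forall v, g v <= p v) -> (forall v, h v <= p v) -> 0 < c < 1 ->
    (forall v, f v = c * g v + (1 - c) * h v) -> forall v, g v = f v].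
Proof.
move=> sp; have fp : supports_face p p by split.
have [q [fq qq0 qmin]] := minimal_supporting_face _ _ (slice_supports_face _ _ v0 fp).
have [sq qp qface] := fq.
have lq : linear_form q.
  apply: sublinear_odd => // v.
  rewrite -[q in q (- v)](qmin (slice q v)); first exact: slice_opp.
    exact: slice_supports_face.
  by move=> w; exact: slice_le_id.
exists q; split => //.
  apply/eqP; rewrite eq_le qp/=.
  by have := le_trans (qq0 (- v0)) (slice_opp _ v0 sp); rewrite linear_formN// lerN2.
move=> g h c lg lh gp hp c01 qgh; apply: linear_form_le_eq => //.
by apply: (qface g h c) => // v; rewrite -qgh.
Qed.

End sublinear.

(** * Sublinear maps from cones *)

Section cone_infimum.
Context {R : realType} {V : lmodType R}.

(** The largest function whose epigraph contains [D]; both gauges used below,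
    that of an order unit and that of a positive functional, have this form. *)
Definition cone_inf (D : R -> V -> Prop) v := inf [set t | D t v].

Context (D : R -> V -> Prop).
Context (DD : forall s t u v, D s u -> D t v -> D (s + t) (u + v))
  (DZ : forall a t v, 0 <= a -> D t v -> D (a * t) (a *: v))
  (D_ge0 : forall t, D t 0 -> 0 <= t) (Dnonempty : forall v, exists t, D t v).

Lemma cone_inf_le t v : D t v -> cone_inf D v <= t.
Proof.
move=> Dtv; apply: ge_inf => //; have [s Ds] := Dnonempty (- v).
exists (- s) => r /= Dr; suff : 0 <= s + r by lra.
by apply: D_ge0; rewrite -(addNr v); exact: DD.
Qed.

Lemma cone_inf_ge z v : (forall t, D t v -> z <= t) -> z <= cone_inf D v.
Proof.
move=> zD; apply: lb_le_inf; last by move=> t; exact: zD.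
by have [t Dt] := Dnonempty v; exists t.
Qed.

Lemma cone_inf_adherent v e : 0 < e -> exists2 t, D t v & t < cone_inf D v + e.
Proof.
move=> e0; have [t ? ?] : exists2 t, [set t | D t v] t & t < cone_inf D v + e.
  apply: inf_adherent => //; split; first exact: Dnonempty.
  have [s Ds] := Dnonempty (- v).
  exists (- s) => r /= Dr; suff : 0 <= s + r by lra.
  by apply: D_ge0; rewrite -(addNr v); exact: DD.
by exists t.
Qed.

Lemma cone_inf_sublinear : sublinear (cone_inf D).
Proof.
split=> [x y|a x].
  rewrite -lerBlDr; apply: cone_inf_ge => s Ds.
  rewrite lerBlDr -lerBlDl; apply: cone_inf_ge => t Dt.
  by rewrite lerBlDl; apply: cone_inf_le; exact: DD.
rewrite le_eqVlt => /predU1P[<-|a0].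
  rewrite scale0r mul0r; have [t Dt] := Dnonempty 0; apply: cone_inf_le.
  by have := DZ _ _ _ (lexx 0) Dt; rewrite mul0r scaler0.
rewrite -ler_pdivrMl//; apply: cone_inf_ge => t Dt; rewrite ler_pdivrMl//.
by apply: cone_inf_le; apply: DZ => //; exact: ltW.
Qed.

End cone_infimum.

(** * Wedges and order units *)

Section wedges.
Context {R : realType} {V : lmodType R} (W : set V) (Ww : is_wedge W).

Lemma wedge0 : W 0.
Proof.
have [[w Ww0] WD] := Ww.
by have := WD 0 0 w w (lexx 0) (lexx 0) Ww0 Ww0; rewrite !scale0r addr0.
Qed.

Lemma wedgeD u v : W u -> W v -> W (u + v).
Proof. by move=> Wu Wv; have := Ww.2 1 1 u v ler01 ler01 Wu Wv; rewrite !scale1r. Qed.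

Lemma wedgeZ a v : 0 <= a -> W v -> W (a *: v).
Proof.
by move=> a0 Wv; have := Ww.2 a 0 v v a0 (lexx 0) Wv Wv; rewrite scale0r addr0.
Qed.

End wedges.

Lemma extremalZ {R : realType} {V : lmodType R} (W : set V) a v :
  is_wedge W -> 0 < a -> extremal W v -> extremal W (a *: v).
Proof.
move=> Ww a0 [Wv ev]; split; first by apply: wedgeZ => //; exact: ltW.
move=> x [xp xv]; have aV : 0 <= a^-1 by rewrite invr_ge0 ltW.
have [] := ev (a^-1 *: x); first split.
- by have := wedgeZ _ Ww _ _ aV xp; rewrite /wle !subr0.
- have := wedgeZ _ Ww _ _ aV xv.
  by rewrite /wle scalerBr scalerA mulVf ?gt_eqF// scale1r.
move=> b xb; exists b.
rewrite scalerA mulrC -scalerA -xb scalerA divff ?gt_eqF// scale1r //.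
Qed.

Lemma dual_wedge_is_wedge {R : realType} {X : normedModType R} (W : set X) :
  is_wedge (dual_wedge W).
Proof.
split; first by exists 0.
move=> a b f g a0 b0 Wf Wg x Wx.
by rewrite [leRHS](_ : _ = a * f x + b * g x)// addr_ge0// mulr_ge0 ?Wf ?Wg.
Qed.

(** An interior point is an order unit, with a bound linear in the norm: the
    vector [e - w] is in [W] as soon as [w] is shorter than the radius of a ball
    around [e] inside [W]. *)
Lemma interior_order_unit {R : realType} {X : normedModType R} (W : set X) e :
  is_wedge W -> interior W e ->
  exists2 C : R, 0 < C & forall v, W ((C * `|v|) *: e - v).
Proof.
move=> Ww; rewrite /interior/= -nbhs_ballE => -[r /= r0 rW].
exists (2 / r); first by rewrite divr_gt0.
move=> v; have [->|v0] := eqVneq v 0.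
  by rewrite normr0 mulr0 scale0r subr0; exact: wedge0.
have nv0 : 0 < `|v| by rewrite normr_gt0.
have -> : (2 / r * `|v|) *: e - v =
    (2 / r * `|v|) *: (e - (r / 2 / `|v|) *: v).
  rewrite scalerBr scalerA; congr (_ - _).
  rewrite -[LHS]scale1r; congr (_ *: _); field.
  by rewrite !gt_eqF.
apply: wedgeZ => //; first by rewrite mulr_ge0// divr_ge0// ltW.
apply: rW; rewrite -ball_normE /ball_/= opprB addrC subrK normrZ.
rewrite ger0_norm ?divr_ge0 ?ltW//.
by rewrite divfK ?gt_eqF// ltr_pdivrMr//; lra.
Qed.

Section bounded_forms.
Context {R : realType} {X : normedModType R}.

Lemma linear_form_bounded (f : X -> R) (C : R) : linear_form f ->
  (forall x, f x <= C * `|x|) -> f \in bounded_linear X R.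
Proof.
move=> lf fC; apply/bounded_linearP; split => //.
exists `|C| => // x; apply: le_trans (_ : C * `|x| <= _); last first.
  by rewrite ler_wpM2r// ler_norm.
by rewrite ler_norml fC andbT; have := fC (- x); rewrite linear_formN// normrN; lra.
Qed.

Lemma dual_linear_form (f : dual X) : linear_form f.
Proof. by move=> a x y; rewrite linearP. Qed.

Lemma norming_form (x : X) : exists2 f : dual X, f x = `|x| & forall v, f v <= `|v|.
Proof.
have sn : sublinear (fun v : X => `|v|).
  split=> [u v|a v a0]; first exact: ler_normD.
  by rewrite normrZ ger0_norm.
have [f [lf fn fx _]] := extremal_hahn_banach _ x sn.
have bf : f \in bounded_linear X R.
  by apply: (linear_form_bounded f 1) => // v; rewrite mul1r.
by exists (BoundedOp bf).
Qed.

End bounded_forms.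

(** Compare [x0'] with a functional of norm at most one that norms [x]: an
    interior point of the dual wedge controls the norm on the wedge. *)
Lemma interior_dual_wedge_norm {R : realType} {X : normedModType R} (W : set X)
    (x0' : dual X) : interior (dual_wedge W) x0' ->
  exists2 C : R, 0 < C & forall x, W x -> `|x| <= C * x0' x.
Proof.
move=> ix0'.
have [C C0 Cx] := interior_order_unit _ _ (dual_wedge_is_wedge W) ix0'.
exists C => // x Wx; have [f fx fn] := norming_form x.
have x0'x : 0 <= x0' x by have /interior_subset := ix0'; apply.
have f1 : `|f| <= 1.
  apply: op_norm_min => v v1; apply: le_trans v1.
  rewrite ler_norml fn andbT.
  by have := fn (- v); rewrite linearN normrN; lra.
have /(_ x Wx) := Cx f.
rewrite [X in 0 <= X](_ : _ = C * `|f| * x0' x - f x)// fx subr_ge0 => /le_trans; apply.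
by rewrite ler_wpM2r// ler_piMr// ltW.
Qed.

(** * Extremal functionals determine a closed wedge *)

Section extremal_functionals.
Context {R : realType} {Y : normedModType R} (W : set Y) (e : Y) (C : R).
Context (Ww : is_wedge W) (C0 : 0 < C)
  (eC : forall y, W ((C * `|y|) *: e - y)).

Lemma positive_form_le (f : Y -> R) : linear_form f -> (forall y, W y -> 0 <= f y) ->
  forall y, f y <= C * `|y| * f e.
Proof.
move=> lf fW y; have := fW _ (eC y).
by rewrite linear_formD// linear_formN// linear_formZ// subr_ge0.
Qed.

Lemma positive_form_eq0 (f : Y -> R) : linear_form f -> (forall y, W y -> 0 <= f y) ->
  f e = 0 -> forall y, f y = 0.
Proof.
move=> lf fW fe y; have := positive_form_le f lf fW y.
have := positive_form_le f lf fW (- y).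
by rewrite fe !mulr0 linear_formN//; lra.
Qed.

(** The linear forms below the gauge [v |-> inf {t | v <= t e}] are exactly the
    positive forms with value [1] at [e], and the extreme ones among them are
    extremal in the dual wedge.  One of them attains the gauge at [- y], so the
    hypothesis bounds that gauge by [0]; then [d e + y] is in [W] for all
    [d > 0], and so is the limit [y]. *)
Lemma extremal_forms_determine_wedge y : closed W ->
  (forall y' : dual Y, extremal (dual_wedge W) y' -> y' e = 1 -> 0 <= y' y) ->
  W y.
Proof.
move=> Wc y'y; have [//|nWy] := pselect (W y).
have We : W e.
  have k0 : 0 < C * `|e| + 1 by rewrite ltr_wpDl// mulr_ge0// ltW.
  have := eC (- e); rewrite normrN opprK -[X in _ + X]scale1r -scalerDl.
  move/(wedgeZ _ Ww (C * `|e| + 1)^-1); rewrite scalerA mulVf ?gt_eqF// scale1r.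
  by apply; rewrite invr_ge0 ltW.
(* If [- e] were in [W], then [W] would be the whole space and the gauge would
   be infinite. *)
have nWe : ~ W (- e).
  move=> WNe; apply: nWy.
  have WyN : W (y + (C * `|y|) *: e) by have := eC (- y); rewrite normrN opprK addrC.
  have := wedgeD _ Ww _ _ WyN (wedgeZ _ Ww (C * `|y|) _ _ WNe).
  by rewrite scalerN addrK; apply; rewrite mulr_ge0// ltW.
pose D (t : R) v := W (t *: e - v).
have DD s t u v : D s u -> D t v -> D (s + t) (u + v).
  by move=> Ds Dt; rewrite /D scalerDl opprD addrACA; exact: wedgeD.
have DZ a t v : 0 <= a -> D t v -> D (a * t) (a *: v).
  by move=> a0 Dt; rewrite /D -scalerA -scalerBr; exact: wedgeZ.
have D_ge0 t : D t 0 -> 0 <= t.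
  rewrite /D subr0 leNgt => Wt; apply/negP => t0; apply: nWe.
  have := wedgeZ _ Ww (- t^-1) _ _ Wt.
  rewrite scalerA mulNr mulVf ?lt_eqF// scaleN1r; apply.
  by rewrite oppr_ge0 invr_le0 ltW.
have Dne v : exists t, D t v by exists (C * `|v|); exact: eC.
have p_le := cone_inf_le D DD D_ge0 Dne.
have sp := cone_inf_sublinear D DD DZ D_ge0 Dne.
have [f [lf fp fy fext]] := extremal_hahn_banach _ (- y) sp.
have pos_le g : linear_form g -> (forall z, W z -> 0 <= g z) -> g e = 1 ->
    forall v, g v <= cone_inf D v.
  move=> lg gW ge v; apply: cone_inf_ge => // t /gW.
  by rewrite linear_formD// linear_formN// linear_formZ// ge mulr1 subr_ge0.
have fW z : W z -> 0 <= f z.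
  move=> Wz; have : f (- z) <= 0.
    by apply: le_trans (fp _) _; apply: p_le; rewrite /D scale0r sub0r opprK.
  by rewrite linear_formN//; lra.
have fe : f e = 1.
  have : f e <= 1.
    by apply: le_trans (fp _) (p_le _ _ _); rewrite /D scale1r subrr; exact: wedge0.
  have : f (- e) <= -1.
    by apply: le_trans (fp _) (p_le _ _ _); rewrite /D scaleN1r subrr; exact: wedge0.
  by rewrite linear_formN//; lra.
have bf : f \in bounded_linear Y R.
  apply: (linear_form_bounded f C) => // v.
  by have := positive_form_le f lf fW v; rewrite fe mulr1.
pose F : dual Y := BoundedOp bf.
have Fext : extremal (dual_wedge W) F.
  split=> // g [g0 gF]; exists (g e).
  have {}g0 z : W z -> 0 <= g z by move/g0; rewrite /= subr0.
  have {}gF z : W z -> 0 <= f z - g z by move/gF.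
  have lg := dual_linear_form g.
  pose h z := f z - g z.
  have lh : linear_form h by move=> a u v; rewrite /h lf lg; ring.
  suff gfe z : g z = g e * f z by apply: val_inj; apply/funext.
  have ge0 := g0 _ We; have ge1 := gF _ We; rewrite fe in ge1.
  have [ge|ge] := eqVneq (g e) 0.
    by rewrite ge mul0r (positive_form_eq0 g).
  have [ge'|ge'] := eqVneq (g e) 1.
    have := positive_form_eq0 h lh gF; rewrite /h fe ge' subrr mul1r.
    by move=> /(_ erefl z)/eqP; rewrite subr_eq0 => /eqP.
  (* [f] is the convex combination of the normalizations of [g] and [f - g],
     with weights [g e] and [1 - g e], so extremeness gives [g / g e = f]. *)
  have c01 : 0 < g e < 1 by rewrite !lt_def ge ge0 eq_sym ge'/=; lra.
  have ng : 1 - g e != 0 by rewrite subr_eq0 eq_sym.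
  rewrite -(fext (fun v => (g e)^-1 * g v) (fun v => (1 - g e)^-1 * h v) (g e)) //.
  - by rewrite mulrA divff// mul1r.
  - by move=> a u v; rewrite lg; ring.
  - by move=> a u v; rewrite lh; ring.
  - apply: pos_le => [a u v|w Ww'|]; first by rewrite lg; ring.
      by rewrite mulr_ge0 ?invr_ge0// g0.
    by rewrite mulVf.
  - apply: pos_le => [a u v|w Ww'|]; first by rewrite lh; ring.
      by rewrite mulr_ge0 ?invr_ge0 ?gF//; lra.
    by rewrite /h fe mulVf.
  - by move=> v; rewrite !mulrA !divff// !mul1r /h; ring.
have := y'y F Fext fe => /= fy0.
have {}fy : cone_inf D (- y) <= 0 by rewrite -fy linear_formN//; lra.
have Wy_eps (d : R) : 0 < d -> W (d *: e + y).
  move=> d0; have [t Dt td] := cone_inf_adherent D DD D_ge0 Dne (- y) d d0.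
  have dt : 0 <= d - t by lra.
  have := wedgeD _ Ww _ _ (wedgeZ _ Ww _ _ dt We) Dt.
  by rewrite opprK addrA -scalerDl subrK.
apply: Wc => B; rewrite -nbhs_ballE => -[r /= r0 rB].
have d0 : 0 < r / (`|e| + 1) by rewrite divr_gt0// ltr_wpDl.
exists (r / (`|e| + 1) *: e + y); split; first exact: Wy_eps.
apply: rB; rewrite -ball_normE /ball_/= opprD addrCA subrr addr0 normrN normrZ.
rewrite gtr0_norm// -mulrAC ltr_pdivrMr ?ltr_wpDl// ltr_pM2l//.
by rewrite ltrDl.
Qed.

End extremal_functionals.

(** * Rank one operators and their linear combinations *)

Section rank_one.
Context {R : realType} {X Y : normedModType R}.
Implicit Types (f : dual X) (y : Y) (T : approx_op X Y).

Lemma rank_one_bounded f y : (fun x => f x *: y) \in bounded_linear X Y.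
Proof.
apply/bounded_linearP; split=> [a u v|]; first by rewrite linearP scalerDl scalerA.
exists (`|f| * `|y|); first exact: mulr_ge0.
by move=> x; rewrite normrZ mulrAC ler_wpM2r//; exact: op_norm_le.
Qed.

Lemma finite_rank_approximable (T : bounded_op X Y) :
  finite_rank T -> T \in @approximable R X Y.
Proof. by move=> fT; apply/asboolP; exact: subset_closure. Qed.

Lemma rank_one_approximable f y :
  BoundedOp (rank_one_bounded f y) \in @approximable R X Y.
Proof.
apply: finite_rank_approximable; exists [set y]; first exact: finite_set1.
by move=> _ [x _ <-]; exists 1%N, (fun=> f x), (fun=> y); split => //; rewrite big_ord1.
Qed.

Definition rank_one f y : approx_op X Y := ApproxOp (rank_one_approximable f y).

Lemma aopD (S T : approx_op X Y) x : (S + T) x = S x + T x. Proof. by []. Qed.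
Lemma aopN (T : approx_op X Y) x : (- T) x = - T x. Proof. by []. Qed.

Lemma dual_comp_bounded (g : dual Y) (T : approx_op X Y) :
  (fun x => g (T x) : R) \in bounded_linear X R.
Proof.
apply/bounded_linearP; split=> [a u v|]; first by rewrite !linearP.
exists (`|g| * `|T|); first exact: mulr_ge0.
move=> x; apply: le_trans (op_norm_le g (T x)) _.
by rewrite -mulrA ler_wpM2l ?op_norm_ge0//; exact: op_norm_le.
Qed.

(** Span of a list by recursion on the list, so that generators can be removed
    one at a time without speaking of bases. *)
Fixpoint span_seq (s : seq Y) (z : Y) : Prop :=
  if s is b :: s' then exists c : R, span_seq s' (z - c *: b) else z = 0.

Lemma span_seqP s a u v : span_seq s u -> span_seq s v -> span_seq s (a *: u + v).
Proof.
elim: s u v => [|b s IH] u v /=; first by move=> -> ->; rewrite scaler0 addr0.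
move=> [c cu] [d dv]; exists (a * c + d).
rewrite scalerDl opprD addrACA -scalerA -scalerBr; exact: IH.
Qed.

Lemma span_seq0 s : span_seq s 0.
Proof. by elim: s => //= b s IH; exists 0; rewrite scale0r subr0. Qed.

Lemma span_seq_mem s b : b \in s -> span_seq s b.
Proof.
elim: s => //= a s IH; rewrite inE => /predU1P[->|/IH bs].
  by exists 1; rewrite scale1r subrr; exact: span_seq0.
by exists 0; rewrite scale0r subr0.
Qed.

Lemma span_seq_map (P : {linear Y -> Y}) s z :
  span_seq s z -> span_seq (map P s) (P z).
Proof.
elim: s z => [|b s IH] z /=; first by move=> ->; rewrite linear0.
by move=> [c /IH]; rewrite linearB linearZ; exists c.
Qed.

Lemma lspan_span_seq s z : lspan [set b | b \in s] z -> span_seq s z.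
Proof.
move=> [n [c [v [vs ->]]]]; elim/big_ind: _ => [|u w su sw|i _].
- exact: span_seq0.
- by rewrite -[u]scale1r; exact: span_seqP.
- have := span_seqP s (c i) _ _ (span_seq_mem _ _ (vs i)) (span_seq0 s).
  by rewrite addr0.
Qed.

(** Induction on the number of generators of the range.  For a generator
    [b != 0], take [g] bounded with [g b = `|b|] and let [P] be the projection
    along [b] onto the kernel of [g].  Then [P \o T] differs from [T] by a rank
    one operator, and its range is spanned by the images under [P] of the
    remaining generators, because [P b = 0]. *)
Lemma eq0_finite_rank (psi : approx_op X Y -> R) : linear_form psi ->
  (forall f y, psi (rank_one f y) = 0) ->
  forall T : approx_op X Y, finite_rank T -> psi T = 0.
Proof.
move=> lpsi psi1 T [B /finite_seqP[s ->] /= Ts].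
have {}Ts x : span_seq s (T x) by apply: lspan_span_seq; apply: Ts; exists x.
elim: {s}(size s) {-2}s (erefl (size s)) T Ts => [|n IH] [|b s]//= sn T Ts.
  rewrite (_ : T = 0) ?linear_form0//.
  by apply: val_inj; apply: val_inj; apply/funext => x; exact: Ts.
move: sn => [sn].
have [b0|b0] := eqVneq b 0.
  by apply: (IH s) => // x; have [c] := Ts x; rewrite b0 scaler0 subr0.
have [g gb _] := norming_form b.
have nb : `|b| != 0 by rewrite normr_eq0.
pose P y := y - (g y / `|b|) *: b.
have lP : linear P.
  move=> a u v; rewrite /P linearP/= mulrDl scalerDl opprD addrACA scalerBr scalerA.
  by rewrite mulrA.
pose PL : {linear Y -> Y} := HB.pack P (GRing.isLinear.Build _ _ _ _ P lP).
have Pb : P b = 0 by rewrite /P gb divff// scale1r subrr.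
pose r := rank_one (BoundedOp (dual_comp_bounded g T)) (`|b|^-1 *: b).
rewrite -[T](subrK r) linear_formD// psi1 addr0.
apply: (IH (map PL s)); first by rewrite size_map.
move=> x; rewrite aopD aopN /=.
have -> : T x - g (T x) *: (`|b|^-1 *: b) = P (T x) by rewrite /P scalerA.
have [c] := Ts x; move/(span_seq_map PL).
by rewrite linearB linearZ/= Pb scaler0 subr0.
Qed.

Lemma eq0_approx_op (psi : dual (approx_op X Y)) :
  (forall f y, psi (rank_one f y) = 0) -> forall T, psi T = 0.
Proof.
move=> psi1 T; apply/eqP; rewrite -normr_le0; apply/ler_addgt0Pr => e e0.
rewrite add0r.
have k0 : 0 < e / (`|psi| + 1) by rewrite divr_gt0// ltr_wpDl.
have /asboolP/closure_finite_rankP/(_ _ k0)[S fS TS] := aop_valP T.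
pose S' := ApproxOp (finite_rank_approximable _ fS).
have psiS : psi S' = 0 by apply: eq0_finite_rank => //; exact: dual_linear_form.
rewrite -[psi T]subr0 -psiS -linearB.
apply: le_trans (op_norm_le psi _) _.
apply: (@le_trans _ _ ((`|psi| + 1) * (e / (`|psi| + 1)))).
  by apply: ler_pM => //; [exact: op_norm_ge0|rewrite lerDl|exact: ltW].
by rewrite mulrC divfK// gt_eqF// ltr_wpDl.
Qed.

End rank_one.

(** * The ordered space of approximable operators *)

Section positive_operators.
Context {R : realType} {X Y : normedModType R} (Xp : set X) (Yp : set Y).
Context (y0 : Y) (x0' : dual X) (Xw : is_wedge Xp) (Yw : is_wedge Yp).
Context (iy0 : interior Yp y0) (ix0' : interior (dual_wedge Xp) x0').

Lemma positive_aops_is_wedge : is_wedge (positive_aops Xp Yp).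
Proof.
split; first by exists 0 => _ [x _ <-]; exact: wedge0.
move=> a b S T a0 b0 Sp Tp _ [x Xx <-]; apply: Yw.2 => //.
  by apply: Sp; exists x.
by apply: Tp; exists x.
Qed.

(** For [x] in [Xp], [T x] is at most a multiple of [`|T x|] times [y0], and
    [`|T x|] is at most a multiple of [`|T| * x0' x]. *)
Lemma rank_one_order_unit : exists2 K : R, 0 < K &
  forall T, positive_aops Xp Yp ((K * `|T|) *: rank_one x0' y0 - T).
Proof.
have [C C0 Cy] := interior_order_unit _ _ Yw iy0.
have [D D0 Dx] := interior_dual_wedge_norm _ _ ix0'.
exists (C * D); first exact: mulr_gt0.
move=> T _ [x Xx <-].
have -> : ((C * D * `|T|) *: rank_one x0' y0 - T) x =
    (C * (`|T| * (D * x0' x) - `|T x|)) *: y0 + ((C * `|T x|) *: y0 - T x).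
  rewrite addrA -scalerDl; congr (_ - _).
  by rewrite [LHS]scalerA; congr (_ *: _); ring.
apply: wedgeD => //; apply: wedgeZ => //; last exact: interior_subset.
rewrite mulr_ge0 ?(ltW C0)// subr_ge0.
apply: le_trans (op_norm_le T x) _.
by rewrite ler_wpM2l ?op_norm_ge0//; exact: Dx.
Qed.

(** A positive multiple of any nonzero extremal [x] satisfies the normalization,
    as [x0'] is strictly positive on nonzero vectors of [Xp]; so [T x] is in [Yp] for
    [x] extremal, and the set of such [x] is closed and convex. *)
Lemma positive_aops_from_extremal (T : approx_op X Y) : closed Yp ->
  Xp `<=` closure (convex_hull (extremal Xp)) ->
  (forall x (y' : dual Y), extremal Xp x -> extremal (dual_wedge Yp) y' ->
     y' y0 * x0' x = 1 -> 0 <= y' (T x)) ->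
  positive_aops Xp Yp T.
Proof.
move=> Yc Xh Tp.
have [C C0 Cy] := interior_order_unit _ _ Yw iy0.
have [D D0 Dx] := interior_dual_wedge_norm _ _ ix0'.
have Text x : extremal Xp x -> Yp (T x).
  move=> ex; have [->|x0] := eqVneq x 0; first by rewrite linear0; exact: wedge0.
  have x0'x : 0 < x0' x.
    have := Dx x ex.1; rewrite -normr_gt0 in x0.
    by move/(lt_le_trans x0); rewrite pmulr_rgt0.
  have x0'V : 0 < (x0' x)^-1 by rewrite invr_gt0.
  apply: (extremal_forms_determine_wedge _ y0 C) => // y' ey' y'y0.
  rewrite -(pmulr_rge0 _ x0'V).
  rewrite -(linear_formZ _ (dual_linear_form y')) -linearZ; apply: Tp => //.
    exact: extremalZ.
  by rewrite y'y0 mul1r (linear_formZ _ (dual_linear_form x0')) mulVf// gt_eqF.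
have Tcts : continuous (T : X -> Y).
  apply: bounded_linear_continuous; apply/linear_boundedP => /=.
  exists `|T|; split; first exact: ger0_real.
  by move=> r Tr x; apply: le_trans (op_norm_le T x) _; rewrite ler_wpM2r// ltW.
have Tconv : convex_hull (extremal Xp) `<=` [set x | Yp (T x)].
  apply: smallest_sub => //= u v l; rewrite !inE /= => Yu Yv.
  rewrite (_ : T _ = l%:num *: T u + (1 - l%:num) *: T v).
    by apply: Yw.2 => //; rewrite subr_ge0.
  by rewrite linearD !linearZ.
move=> _ [x Xx <-]; apply: Yc => B /Tcts /(Xh _ Xx)[u [/Tconv Yu Bu]].
by exists (T u).
Qed.

End positive_operators.

(** * Extremal functionals and moduli *)

(** Only [phi s <= `|phi x|] needs an argument.  Whenever [u] is above [0] and
    [x], the vector [2 u - x] is above [x] and [- x], hence above [s]; so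
    [(phi s + phi x) / 2] is at most the infimum of all such [phi u].  This
    infimum is sublinear in [x], and by Hahn-Banach it equals [f x] for a
    functional [f] between [0] and [phi], that is, [a * phi x] with
    [0 <= a <= 1]. *)
Lemma extremal_form_modulus {R : realType} {E : normedModType R} (W : set E) (e : E)
    (C : R) (phi : dual E) (x s : E) : is_wedge W -> W e -> 0 < C ->
  (forall v, W ((C * `|v|) *: e - v)) -> extremal (dual_wedge W) phi ->
  is_sup W [set x; - x] s -> phi s = `|phi x|.
Proof.
move=> Ww We C0 eC [phiW phiext] [xs smin].
have lphi := dual_linear_form phi.
have [phie|phie] := eqVneq (phi e) 0.
  by rewrite !(positive_form_eq0 _ _ _ eC _ lphi phiW phie) normr0.
have phie0 : 0 < phi e by rewrite lt_def phie phiW.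
pose D (t : R) v := exists2 u, W u /\ W (u - v) & t = phi u.
have DD a b u v : D a u -> D b v -> D (a + b) (u + v).
  move=> [u' [Wu Wuu] ->] [v' [Wv Wvv] ->]; exists (u' + v'); last by rewrite linearD.
  by split; [exact: wedgeD|rewrite opprD addrACA; exact: wedgeD].
have DZ a t v : 0 <= a -> D t v -> D (a * t) (a *: v).
  move=> a0 [u [Wu Wuv] ->]; exists (a *: u); last by rewrite linear_formZ.
  by split; [exact: wedgeZ|rewrite -scalerBr; exact: wedgeZ].
have D_ge0 t : D t 0 -> 0 <= t by move=> [u [Wu _] ->]; exact: phiW.
have Dunit v : D (phi ((C * `|v|) *: e)) v.
  exists ((C * `|v|) *: e) => //; split=> //.
  by apply: wedgeZ => //; rewrite mulr_ge0// ltW.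
have Dne v : exists t, D t v by eexists; exact: Dunit.
have p_le := cone_inf_le D DD D_ge0 Dne.
have sp := cone_inf_sublinear D DD DZ D_ge0 Dne.
have [f [lf fp fx _]] := extremal_hahn_banach _ x sp.
have f_ge0 v : W v -> 0 <= f v.
  move=> Wv; suff : f (- v) <= 0 by rewrite linear_formN//; lra.
  apply: le_trans (fp _) (p_le _ _ _); exists 0; last by rewrite linear0.
  by rewrite opprK add0r; split=> //; exact: wedge0.
have f_le v : W v -> f v <= phi v.
  move=> Wv; apply: le_trans (fp _) (p_le _ _ _); exists v => //.
  by rewrite subrr; split=> //; exact: wedge0.
have bf : f \in bounded_linear E R.
  apply: (linear_form_bounded f (C * phi e)) => // v.
  apply: le_trans (fp _) _; apply: le_trans (p_le _ _ (Dunit v)) _.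
  by rewrite linear_formZ// mulrAC.
have [|a fa] := phiext (BoundedOp bf).
  split=> v Wv; last by rewrite [leRHS](_ : _ = phi v - f v)// subr_ge0 f_le.
  by rewrite [leRHS](_ : _ = f v - 0)// subr0 f_ge0.
have {}fa v : f v = a * phi v by rewrite -[f]/(bop_val (BoundedOp bf)) fa.
have a0 : 0 <= a by rewrite -(pmulr_lge0 _ phie0) -fa f_ge0.
have a1 : a <= 1 by rewrite -(ler_pM2r phie0) mul1r -fa f_le.
have sxp : (phi s + phi x) / 2 <= cone_inf D x.
  apply: cone_inf_ge => // _ [u [Wu Wux] ->].
  have : wle W s (u *+ 2 - x).
    apply: smin => _ [->|->]; rewrite /wle.
      by rewrite -addrA -opprD -mulr2n -mulrnBl mulr2n; exact: wedgeD.
    by rewrite opprK subrK mulr2n; exact: wedgeD.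
  move=> /phiW; rewrite 2!linearB/= mulr2n linearD/=; lra.
have phixs : phi x <= phi s.
  by have /phiW := xs x (or_introl erefl); rewrite linearB subr_ge0.
have phiNxs : - phi x <= phi s.
  by have /phiW := xs (- x) (or_intror erefl); rewrite linearB subr_ge0 linearN.
rewrite -fx fa in sxp.
have [x0|x0] := leP 0 (phi x).
  by rewrite ger0_norm//; nra.
by rewrite ltr0_norm//; nra.
Qed.

(** * Extremality of the tensors *)

Section tensor_extremal.
Context {R : realType} {X Y : normedModType R} (Xp : set X) (Yp : set Y).
Context (y0 : Y) (x0' : dual X) (Yw : is_wedge Yp).
Context (iy0 : interior Yp y0) (ix0' : interior (dual_wedge Xp) x0').

Lemma rank_one_positive (f : dual X) y : dual_wedge Xp f -> Yp y ->
  positive_aops Xp Yp (rank_one f y).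
Proof. by move=> fp Yy _ [x Xx <-]; apply: wedgeZ => //; exact: fp. Qed.

Lemma rank_one_norm (f : dual X) (y : Y) : `|rank_one f y| <= `|f| * `|y|.
Proof.
apply: op_norm_min => x x1; rewrite normrZ ler_wpM2r//.
by apply: le_trans (op_norm_le f x) _; rewrite ler_piMr// op_norm_ge0.
Qed.

Lemma rank_one_linearl (y : Y) a f g : rank_one (a *: f + g) y =
  a *: rank_one f y + rank_one g y :> approx_op X Y.
Proof.
apply: val_inj; apply: val_inj; apply/funext => x.
by rewrite [LHS]scalerDl [X in X + _ = _](_ : _ = (a * f x) *: y)// -scalerA.
Qed.

Lemma rank_one_linearr (f : dual X) a (y z : Y) : rank_one f (a *: y + z) =
  a *: rank_one f y + rank_one f z :> approx_op X Y.
Proof.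
apply: val_inj; apply: val_inj; apply/funext => x.
by rewrite [LHS]scalerDr scalerA mulrC -scalerA.
Qed.

(** For [y] in [Yp], extremality of [x] in the bidual makes
    [f |-> psi (rank_one f y)] a multiple of [x], with factor [c y / x0' x] where
    [c y = psi (rank_one x0' y)]; then extremality of [y'] applies to
    [c / x0' x].  The formula extends to all [y] because [Yp] spans. *)
Lemma tensor_extremal (x : X) (y' : dual Y) : Xp x ->
  extremal (dual_wedge (dual_wedge Xp)) (bidual_embedding x) ->
  extremal (dual_wedge Yp) y' -> 0 < x0' x ->
  extremal (dual_wedge (positive_aops Xp Yp)) (tensor y' x).
Proof.
move=> Xx ex ey' x0'x.
split=> [T Tp|psi [psi0 psile]]; first by apply: ey'.1; apply: Tp; exists x.
have {}psi0 T : positive_aops Xp Yp T -> 0 <= psi T by move/psi0; rewrite /= subr0.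
have {}psile T : positive_aops Xp Yp T -> psi T <= y' (T x).
  by move/psile; rewrite [X in 0 <= X -> _](_ : _ = y' (T x) - psi T)// subr_ge0.
have [C C0 Cy] := interior_order_unit _ _ Yw iy0.
have [D D0 Dx] := interior_order_unit _ _ (dual_wedge_is_wedge Xp) ix0'.
have bG y : (fun f : dual X => psi (rank_one f y) : R) \in bounded_linear (dual X) R.
  apply: (linear_form_bounded _ (`|psi| * `|y|)) => [a f g|f].
    by rewrite rank_one_linearl; exact: dual_linear_form.
  apply: le_trans (ler_norm _) _; apply: le_trans (op_norm_le _ _) _.
  by rewrite -mulrA ler_wpM2l ?op_norm_ge0// mulrC; exact: rank_one_norm.
have bc : (fun y => psi (rank_one x0' y) : R) \in bounded_linear Y R.
  apply: (linear_form_bounded _ (`|psi| * `|x0'|)) => [a y z|y].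
    by rewrite rank_one_linearr; exact: dual_linear_form.
  apply: le_trans (ler_norm _) _; apply: le_trans (op_norm_le _ _) _.
  by rewrite -mulrA ler_wpM2l ?op_norm_ge0//; exact: rank_one_norm.
pose c : dual Y := BoundedOp bc.
have bidualE y : Yp y -> exists k, forall f, psi (rank_one f y) = k * f x.
  move=> Yy; have y'y : 0 <= y' y by exact: ey'.1.
  pose G : dual (dual X) := BoundedOp (bG y).
  have G0 f : dual_wedge Xp f -> 0 <= G f.
    by move=> fp; apply: psi0; exact: rank_one_positive.
  have Gle f : dual_wedge Xp f -> G f <= y' y * f x.
    move=> fp; have := psile _ (rank_one_positive f y fp Yy).
    by rewrite /= linear_formZ ?(mulrC (f x))//; exact: dual_linear_form.
  (* When [y' y = 0] the functional [G] is squeezed between [0] and [0] on the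
     dual wedge, which spans since it has an interior point. *)
  move: y'y; rewrite le_eqVlt => /predU1P[y'y|y'y].
    exists 0 => f; rewrite mul0r.
    apply: (positive_form_eq0 (dual_wedge Xp) x0' D Dx G) => //.
      exact: dual_linear_form.
    have x0'p : dual_wedge Xp x0' by exact: interior_subset.
    by apply/eqP; rewrite eq_le G0// andbT; have := Gle _ x0'p; rewrite -y'y mul0r.
  have [|k Gk] := (extremalZ _ _ _ (dual_wedge_is_wedge _) y'y ex).2 G.
    split=> f fp; first by rewrite [leRHS](_ : _ = G f - 0)// subr0 G0.
    by rewrite [leRHS](_ : _ = y' y * f x - G f)// subr_ge0 Gle.
  exists (k * y' y) => f; rewrite -[LHS]/(G f) Gk.
  by rewrite [LHS](_ : _ = k * (y' y * f x))// mulrA.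
have cE y f : psi (rank_one f y) * x0' x = c y * f x.
  have Yc z : Yp z -> psi (rank_one f z) * x0' x = c z * f x.
    by move=> /bidualE[k kE]; rewrite /= !kE mulrAC.
  have lr : linear_form (fun z => psi (rank_one f z)).
    by move=> a u v; rewrite rank_one_linearr; exact: dual_linear_form.
  have := Yc _ (Cy y); have := Yc _ (interior_subset iy0).
  have lc := dual_linear_form c.
  rewrite (linear_formD _ lr) (linear_formD _ lc) (linear_formN _ lr).
  rewrite (linear_formN _ lc) (linear_formZ _ lr) (linear_formZ _ lc) => c0E.
  rewrite !mulrDl -![C * `|y| * _ * _]mulrA c0E => /addrI.
  by rewrite !mulNr => /oppr_inj.
have x0'V : 0 <= (x0' x)^-1 by rewrite invr_ge0 ltW.
have [|a ca] := ey'.2 ((x0' x)^-1 *: c).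
  have x0'p : dual_wedge Xp x0' by exact: interior_subset.
  split=> y Yy.
    rewrite [leRHS](_ : _ = (x0' x)^-1 * c y - 0)// subr0 mulr_ge0//.
    by apply: psi0; exact: rank_one_positive.
  rewrite [leRHS](_ : _ = y' y - (x0' x)^-1 * c y)// subr_ge0 ler_pdivrMl//.
  rewrite -(linear_formZ _ (dual_linear_form y')).
  by apply: psile; exact: rank_one_positive.
exists a; apply/eqP; rewrite -subr_eq0; apply/eqP; apply: val_inj; apply/funext => T.
apply: (eq0_approx_op (psi - a *: tensor y' x)) => f y.
rewrite [LHS](_ : _ = psi (rank_one f y) - a * y' (f x *: y))//.
rewrite (linear_formZ _ (dual_linear_form y')).
have : (x0' x)^-1 * c y = a * y' y by rewrite [LHS](_ : _ = ((x0' x)^-1 *: c) y)// ca.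
have -> : psi (rank_one f y) = (x0' x)^-1 * c y * f x.
  by apply: (mulIf (lt0r_neq0 x0'x)); rewrite cE; field; rewrite gt_eqF.
by move=> ->; ring.
Qed.

End tensor_extremal.

(** * Moduli and disjoint decompositions *)

Section modulus.
Context {R : realType} {V : lmodType R} (W : set V) (Ww : is_wedge W).

(** If [w] is below both halves, then [s - 2 w] is above [x] and [- x], hence
    above [s]. *)
Lemma has_modulus_disjoint_parts x : has_modulus W x ->
  exists u v, [/\ W u, W v, disjoint_elts W u v & x = u - v].
Proof.
move=> [s [sx smin]].
have Wsx : W (s - x) by apply: sx; left.
have Wsx' : W (s + x) by rewrite -[x]opprK; apply: sx; right.
have h0 : 0 <= 2^-1 :> R by rewrite invr_ge0.
exists (2^-1 *: (s + x)), (2^-1 *: (s - x)); split; [exact: wedgeZ..| |].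
  split=> [_ [->|->]|w wle2]; first by rewrite /wle subr0; exact: wedgeZ.
    by rewrite /wle subr0; exact: wedgeZ.
  have w1 := wle2 _ (or_introl erefl); have w2 := wle2 _ (or_intror erefl).
  have : wle W s (s - w *+ 2).
    apply: smin => _ [->|->]; rewrite /wle.
      rewrite addrAC (_ : _ - _ = 2 *: (2^-1 *: (s - x) - w)).
        exact: wedgeZ.
      by rewrite [RHS]scalerBr scalerA mulfV// scale1r scaler_nat.
    rewrite opprK addrAC (_ : _ - _ = 2 *: (2^-1 *: (s + x) - w)).
      exact: wedgeZ.
    by rewrite [RHS]scalerBr scalerA mulfV// scale1r scaler_nat.
  rewrite /wle addrAC subrr add0r => /(wedgeZ _ Ww _ _ h0).
  by rewrite sub0r -(scaler_nat 2 w) -scalerN scalerA mulVf// scale1r.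
by rewrite -scalerBr opprB addrC addrA subrK -mulr2n -(scaler_nat 2 x) scalerA
  mulVf// scale1r.
Qed.

(** If [w] is above [u - v] and [v - u], then half of [u + v - w] is below both
    [u] and [v], hence below [0]. *)
Lemma disjoint_parts_has_modulus u v : W u -> W v -> disjoint_elts W u v ->
  has_modulus W (u - v).
Proof.
move=> Wu Wv [_ inf0]; exists (u + v); split.
  move=> _ [->|->]; rewrite /wle opprB.
    by rewrite addrC addrA subrK; exact: wedgeD.
  by rewrite opprB addrACA subrr addr0; exact: wedgeD.
move=> w wge; have h0 : 0 <= 2^-1 :> R by rewrite invr_ge0.
have w1 := wge _ (or_introl erefl); have w2 := wge _ (or_intror erefl).
have half (a b : V) : W (w - (b - a)) -> W (a - 2^-1 *: (a + b - w)).
  move=> /(wedgeZ _ Ww _ _ h0); congr W.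
  rewrite [RHS](_ : _ = 2^-1 *: (2 *: a - (a + b - w))).
    congr (_ *: _); rewrite scaler_nat mulr2n !opprB [RHS]addrCA.
    by rewrite opprD addrACA subrr add0r.
  by rewrite [RHS]scalerBr scalerA mulVf// scale1r.
have : wle W (2^-1 *: (u + v - w)) 0.
  apply: inf0 => _ [->|->]; rewrite /wle; last rewrite [u + v]addrC; apply: half => //.
  by rewrite -[v - u]opprB.
rewrite /wle sub0r => /(wedgeZ _ Ww _ _ (ler0n R 2)).
by rewrite scalerN scalerA mulfV// scale1r opprB.
Qed.

End modulus.

(** * The theorem *)

Theorem proposition6p3 (R : realType) (X Y : normedModType R)
    (Xp : set X) (Yp : set Y) (y0 : Y) (x0' : dual X) (T : approx_op X Y)
    (X_neq0 : exists x : X, x != 0) (Y_neq0 : exists y : Y, y != 0)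
    (Xp_cone : is_cone Xp) (Xp_closed : closed Xp)
    (Yp_cone : is_cone Yp) (Yp_closed : closed Yp)
    (Xp_total : total_wedge Xp)
    (Xp_additive : exists N : X -> R, equivalent_norm N /\ additive_on Xp N)
    (Xp_extremal : forall x, extremal Xp x ->
       extremal (dual_wedge (dual_wedge Xp)) (bidual_embedding x))
    (Xp_hull : Xp `<=` closure (convex_hull (extremal Xp)))
    (Yp_interior : interior Yp !=set0)
    (y0_interior : interior Yp y0)
    (x0'_interior : interior (dual_wedge Xp) x0') :
  let S' := extremal_tensors Xp Yp x0' y0 in
  let Phi := evaluation (closure S') in
  let Cp := positive_aops Xp Yp in
  [<-> has_modulus Cp T;
       exists2 tau, range Phi tau &
         forall phi : closure S', S' (set_val phi) -> `|Phi T phi| = tau phi;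
       exists T1 T2 : approx_op X Y,
         [/\ Cp T1, Cp T2, disjoint_elts Cp T1 T2 & T = T1 - T2]].
Proof.
move=> S' Phi Cp.
have Xw := Xp_cone.1; have Yw := Yp_cone.1.
have Cw : is_wedge Cp := positive_aops_is_wedge Xp Yp Yw.
have x0'p : dual_wedge Xp x0' by exact: interior_subset.
have [K K0 unitC] := rank_one_order_unit Xp Yp y0 x0' Yw y0_interior x0'_interior.
have Ce : Cp (rank_one x0' y0).
  by apply: rank_one_positive => //; exact: interior_subset.
have CpP U : (forall phi, S' phi -> 0 <= (phi : dual _) U) -> Cp U.
  move=> S'U; apply: (positive_aops_from_extremal Xp Yp y0 x0') => //.
  by move=> x y' ex ey' xy; apply: (S'U (tensor y' x)); exists x, y'.
have S'_ge0 (phi : dual (approx_op X Y)) : S' phi -> forall U, Cp U -> 0 <= phi U.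
  move=> [x [y' [ex ey' _ ->]]] U Up; apply: ey'.1; apply: Up.
  by exists x => //; exact: ex.1.
tfae.
- move=> [S supS]; exists (Phi S); first by exists S.
  move=> phi [x [y' [ex ey' xy phiE]]].
  rewrite [LHS](_ : _ = `|(set_val phi : dual _) T|)// phiE.
  symmetry; rewrite [LHS](_ : _ = (set_val phi : dual _) S)// phiE.
  apply: (extremal_form_modulus Cp (rank_one x0' y0) K) => //.
  apply: (tensor_extremal Xp Yp y0 x0') => //; [exact: ex.1|exact: Xp_extremal|].
  have x0'x : 0 <= x0' x by apply: x0'p; exact: ex.1.
  rewrite lt_def x0'x andbT; apply/eqP => xe; move: xy; rewrite xe mulr0.
  by move/eqP; rewrite eq_sym oner_eq0.
- move=> [_ [S _ <-] TS]; apply: has_modulus_disjoint_parts => //; exists S.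
  have {}TS (phi : weak_star (approx_op X Y)) : S' phi ->
      `|(phi : dual _) T| = (phi : dual _) S.
    move=> S'phi; have := TS (SigSub (mem_set (subset_closure S'phi))).
    by rewrite set_valE; apply.
  split.
    move=> _ [->|->]; apply: CpP => phi /TS phiS;
      rewrite linearB/= subr_ge0 -phiS ?linearN/= ?ler_norm//.
    by rewrite -normrN ler_norm.
  move=> U TU; apply: CpP => phi S'phi; rewrite linearB/= subr_ge0 -TS//.
  have Uphi V : [set T; - T] V -> phi V <= phi U.
    move=> TV; rewrite -subr_ge0 -linearB; exact: S'_ge0 (TU V TV).
  rewrite ler_norml lerNl -linearN !Uphi//; [by left|by right].
- move=> [T1 [T2 [T1p T2p T12 ->]]]; exact: disjoint_parts_has_modulus.
Qed.
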